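(* Let $f:\mathbb{R}^n\to(-\infty,+\infty]$ be a proper closed convex function with $S=\arg\min f$ nonempty, let $\bar x\in S$, and let $\mathcal{M}$ be a $C^1$-smooth embedded submanifold of $\mathbb{R}^n$ containing $\bar x$ (with induced metric). Suppose $f$ is $C^1$-partly smooth around $\bar x$ relative to $\mathcal{M}$ with $0\in\operatorname{ri}\partial f(\bar x)$. Then the following are equivalent: (i) there exist $\epsilon,\mu>0$ such that $\mu\,\operatorname{dist}(x,S)\le\operatorname{dist}(0,\partial f(x))$ for all $x\in B_\epsilon(\bar x)$; (ii) there exist $\epsilon,\mu>0$ such that $\mu\,\operatorname{dist}(x,S\cap\mathcal{M})\le\|\nabla_{\mathcal{M}}f(x)\|$ for all $x\in B_\epsilon(\bar x)\cap\mathcal{M}$.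
   Context: Partial smoothness: $f$ is partly smooth at a point $x\in\mathcal M$ relative to a $C^p$ manifold $\mathcal{M}$ (for all subgradients) if: (Regularity) $\hat\partial f(z)=\partial f(z)\neq\varnothing$ for all $z\in\mathcal{M}$ near $x$; (Restricted smoothness) $f|_{\mathcal{M}}$ is $C^p$-smooth around $x$; (Sharpness) $\operatorname{par}\partial f(x)$ (the subspace parallel to the affine hull of $\partial f(x)$) equals the normal space $N_x\mathcal{M}$; (Inner semicontinuity) for every $y\in\partial f(x)$ and every sequence $x_r\to x$ in $\mathcal{M}$ there exist $y_r\in\partial f(x_r)$ with $y_r\to y$. ''$C^1$-partly smooth around $\bar x$ relative to $\mathcal{M}$'' means this holds with $p=1$ at every point of $\mathcal M$ near $\bar x$. $\nabla_{\mathcal M}f(x)$ is the Riemannian gradient of $f|_{\mathcal M}$, i.e. $P_{T_x\mathcal M}\nabla\tilde f(x)$ for a local smooth extension $\tilde f$. $\operatorname{dist}(0,\emptyset)=+\infty$. *)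

(* Defs.v *)
From HB Require Import structures.
From mathcomp Require Import all_boot all_order all_algebra.
From mathcomp Require Import all_classical all_reals ereal.
Set Implicit Arguments. Unset Strict Implicit. Unset Printing Implicit Defensive.
Import Order.TTheory GRing.Theory Num.Theory.
Local Open Scope classical_set_scope.
Local Open Scope ring_scope.

Section Defs.
Variable R : realType.

Definition vec (n : nat) := 'rV[R]_n.
Definition dot {m : nat} (u v : 'rV[R]_m) : R := \sum_(i < m) u 0 i * v 0 i.
Definition enorm {m : nat} (u : 'rV[R]_m) : R := Num.sqrt (dot u u).

Variable n : nat.

(* dist(x, A) = inf_{a in A} |x - a|, with dist(x, emptyset) = +oo *)
Definition dist (x : vec n) (A : set (vec n)) : \bar R :=
  ereal_inf [set (enorm (x - a))%:E | a in A].

Definition seq_cvg (xs : nat -> vec n) (x : vec n) : Prop :=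
  forall e : R, 0 < e -> exists N : nat, forall k, (N <= k)%N -> enorm (xs k - x) < e.

Definition proper_fun (f : vec n -> \bar R) : Prop :=
  (forall x, f x != -oo%E) /\ (exists x, f x \is a fin_num).
Definition lsc (f : vec n -> \bar R) : Prop :=
  forall x (r : R), (r%:E < f x)%E ->
    exists d : R, 0 < d /\ forall y, enorm (y - x) < d -> (r%:E < f y)%E.
Definition convex_fun (f : vec n -> \bar R) : Prop :=
  forall x y (t : R), f x \is a fin_num -> f y \is a fin_num -> 0 <= t <= 1 ->
    (f (t *: x + (1 - t) *: y)%R <= (t * fine (f x) + (1 - t) * fine (f y))%R%:E)%E.
Definition argmin (f : vec n -> \bar R) : set (vec n) :=
  [set x | forall y, (f x <= f y)%E].

Definition frechet_sub (f : vec n -> \bar R) (x : vec n) : set (vec n) :=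
  [set v | f x \is a fin_num /\
     forall e : R, 0 < e -> exists d : R, 0 < d /\
       forall y, enorm (y - x) < d ->
         (f x + (dot v (y - x) - e * enorm (y - x))%R%:E <= f y)%E].

Definition lim_sub (f : vec n -> \bar R) (x : vec n) : set (vec n) :=
  [set v | exists (xs vs : nat -> vec n),
     (forall k, frechet_sub f (xs k) (vs k)) /\ seq_cvg xs x /\ seq_cvg vs v /\
     (forall e : R, 0 < e -> exists N : nat, forall k, (N <= k)%N ->
        (`|f (xs k) - f x| < e%:E)%E)].

(* par C : the linear subspace parallel to aff C (span of differences) *)
Definition par (C : set (vec n)) : set (vec n) :=
  [set v | exists (k : nat) (a : 'I_k -> R) (c d : 'I_k -> vec n),
     (forall i, C (c i) /\ C (d i)) /\ v = \sum_(i < k) a i *: (c i - d i)].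

Definition ri (C : set (vec n)) : set (vec n) :=
  [set y | C y /\ exists e : R, 0 < e /\
     forall p, par C p -> enorm p < e -> C (y + p)].

Definition C1_map {m : nat} (F : vec n -> 'rV[R]_m) (DF : vec n -> 'M[R]_(n, m))
    (U : set (vec n)) : Prop :=
  (forall x, U x -> forall e : R, 0 < e -> exists d : R, 0 < d /\
     forall y, enorm (y - x) < d ->
       enorm (F y - F x - (y - x) *m DF x) <= e * enorm (y - x)) /\
  (forall x, U x -> forall e : R, 0 < e -> exists d : R, 0 < d /\
     forall y, U y -> enorm (y - x) < d -> forall i j, `|DF y i j - DF x i j| < e).

Definition C1_fun (g : vec n -> R) (Dg : vec n -> vec n) (U : set (vec n)) : Prop :=
  (forall x, U x -> forall e : R, 0 < e -> exists d : R, 0 < d /\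
     forall y, enorm (y - x) < d ->
       `|g y - g x - dot (Dg x) (y - x)| <= e * enorm (y - x)) /\
  (forall x, U x -> forall e : R, 0 < e -> exists d : R, 0 < d /\
     forall y, U y -> enorm (y - x) < d -> enorm (Dg y - Dg x) < e).

Definition ball (x : vec n) (r : R) : set (vec n) := [set y | enorm (y - x) < r].

Definition local_defn (M : set (vec n)) (x : vec n) (m : nat)
    (F : vec n -> 'rV[R]_m) (DF : vec n -> 'M[R]_(n, m)) (r : R) : Prop :=
  0 < r /\ C1_map F DF (ball x r) /\ row_full (DF x) /\
  (forall y, enorm (y - x) < r -> (M y <-> F y = 0)).

Definition C1_submanifold (M : set (vec n)) : Prop :=
  forall x, M x -> exists (m : nat) (F : vec n -> 'rV[R]_m) (DF : vec n -> 'M[R]_(n, m)) (r : R),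
    local_defn M x F DF r.

Definition tangent (M : set (vec n)) (x : vec n) : set (vec n) :=
  [set v | exists (m : nat) (F : vec n -> 'rV[R]_m) (DF : vec n -> 'M[R]_(n, m)) (r : R),
     local_defn M x F DF r /\ v *m DF x = 0].
Definition normal (M : set (vec n)) (x : vec n) : set (vec n) :=
  [set w | forall v, tangent M x v -> dot w v = 0].

(* f|_M is C^1 around x: a C^1 local extension g agrees with f on M near x *)
Definition smooth_ext (f : vec n -> \bar R) (M : set (vec n)) (x : vec n)
    (r : R) (g : vec n -> R) (Dg : vec n -> vec n) : Prop :=
  0 < r /\ C1_fun g Dg (ball x r) /\
  forall y, M y -> enorm (y - x) < r -> f y = (g y)%:E.

(* w is the Riemannian gradient of f|_M at x: w = P_{T_x M} (grad g)(x) *)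
Definition rgrad (f : vec n -> \bar R) (M : set (vec n)) (x w : vec n) : Prop :=
  exists (r : R) (g : vec n -> R) (Dg : vec n -> vec n),
    smooth_ext f M x r g Dg /\ tangent M x w /\ normal M x (Dg x - w).

Definition partly_smooth_at (f : vec n -> \bar R) (M : set (vec n)) (x : vec n) : Prop :=
  M x /\
  (exists d : R, 0 < d /\ forall z, M z -> enorm (z - x) < d ->
      frechet_sub f z = lim_sub f z /\ lim_sub f z !=set0) /\
  (exists (r : R) (g : vec n -> R) (Dg : vec n -> vec n), smooth_ext f M x r g Dg) /\
  par (lim_sub f x) = normal M x /\
  (forall y, lim_sub f x y -> forall xs : nat -> vec n, (forall k, M (xs k)) ->
     seq_cvg xs x -> exists (ys : nat -> vec n) (N : nat),
       (forall k, (N <= k)%N -> lim_sub f (xs k) (ys k)) /\ seq_cvg ys y).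

Definition C1_partly_smooth_around (f : vec n -> \bar R) (M : set (vec n)) (xbar : vec n) : Prop :=
  exists d : R, 0 < d /\ forall x, M x -> enorm (x - xbar) < d -> partly_smooth_at f M x.

End Defs.

(* Main.v *)
(** For convex [f] the limiting subdifferential is the convex one, [csub]. With [A = DF xbar] and
    [G = (A^T A)^-1 A^T], whose rows span the normal space at [xbar], the equation
    [F (x - s G) = 0] has a small solution [s] for every [x] near [xbar]. Sharpness, [0] in the
    relative interior and inner semicontinuity give [c > 0] such that, for [y] in [M] near
    [xbar], every unit vector [z] which is normal at [y] or at [xbar] satisfies [c <= <w, z>]
    for some subgradient [w] at [y]. Together with monotonicity this shows that a point near
    [xbar] with a subgradient shorter than [c] lies on [M]; together with the projection onto
    the subdifferential it shows that the Riemannian gradient is a subgradient, hence the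
    shortest one. Thus near [xbar] minimisers lie on [M], [dist 0 (csub f x)] equals the norm
    of the Riemannian gradient on [M], and it is at least [c] off [M]. *)

Require Import Defs.
From HB Require Import structures.
From mathcomp Require Import all_boot all_order all_algebra.
From mathcomp Require Import all_classical all_reals ereal.
From mathcomp Require Import topology normedtype derive ring lra.
Set Implicit Arguments. Unset Strict Implicit. Unset Printing Implicit Defensive.
Import Order.TTheory GRing.Theory Num.Theory numFieldNormedType.Exports.
Local Open Scope classical_set_scope.
Local Open Scope ring_scope.

(** * Euclidean geometry of row vectors, compactness and the pseudo-inverse *)

Lemma sum_ord_le (R : realType) (m : nat) (F : 'I_m -> R) c :
  (forall i, F i <= c) -> \sum_i F i <= m%:R * c.
Proof.
move=> Fc; rewrite (le_trans (ler_sum _ (fun i _ => Fc i))) //.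
by rewrite sumr_const card_ord mulr_natl.
Qed.

Section Euclidean.
Variables (R : realType) (m : nat).
Implicit Types (u v w : 'rV[R]_m) (a : R).

Lemma dot_mx u v : dot u v = (u *m v^T) 0 0.
Proof. by rewrite mxE; apply: eq_bigr => i _; rewrite mxE. Qed.

Lemma dotC u v : dot u v = dot v u.
Proof. by apply: eq_bigr => i _; rewrite mulrC. Qed.

Lemma dotDl u v w : dot (u + v) w = dot u w + dot v w.
Proof. by rewrite !dot_mx mulmxDl mxE. Qed.

Lemma dotNl u w : dot (- u) w = - dot u w.
Proof. by rewrite !dot_mx mulNmx mxE. Qed.

Lemma dotZl a u w : dot (a *: u) w = a * dot u w.
Proof. by rewrite !dot_mx -scalemxAl mxE. Qed.

Lemma dotBl u v w : dot (u - v) w = dot u w - dot v w.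
Proof. by rewrite dotDl dotNl. Qed.

Lemma dotDr u v w : dot w (u + v) = dot w u + dot w v.
Proof. by rewrite dotC dotDl !(dotC w). Qed.

Lemma dotNr u w : dot w (- u) = - dot w u.
Proof. by rewrite dotC dotNl dotC. Qed.

Lemma dotZr a u w : dot w (a *: u) = a * dot w u.
Proof. by rewrite dotC dotZl dotC. Qed.

Lemma dotBr u v w : dot w (u - v) = dot w u - dot w v.
Proof. by rewrite dotDr dotNr. Qed.

Lemma dot0l w : dot 0 w = 0.
Proof. by rewrite dot_mx mul0mx mxE. Qed.

Lemma dot0r w : dot w 0 = 0.
Proof. by rewrite dotC dot0l. Qed.

Definition dotE := (dotDl, dotDr, dotNl, dotNr, dotZl, dotZr).

Lemma dot_ge0 u : 0 <= dot u u.
Proof. by apply: sumr_ge0 => i _; rewrite -expr2 sqr_ge0. Qed.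

Lemma dot_eq0 u : dot u u = 0 -> u = 0.
Proof.
move/eqP; rewrite psumr_eq0 => [/allP h|i _]; last by rewrite -expr2 sqr_ge0.
apply/rowP => i; rewrite mxE; apply/eqP.
by have := h i (mem_index_enum i); rewrite /= mulf_eq0 orbb.
Qed.

Lemma enorm_ge0 u : 0 <= enorm u.
Proof. exact: sqrtr_ge0. Qed.

Lemma enorm_sqr u : enorm u ^+ 2 = dot u u.
Proof. by rewrite sqr_sqrtr // dot_ge0. Qed.

Lemma enorm0 : enorm (0 : 'rV[R]_m) = 0.
Proof. by rewrite /enorm dot0l sqrtr0. Qed.

Lemma enorm_eq0 u : enorm u = 0 -> u = 0.
Proof. by move=> h; apply: dot_eq0; rewrite -enorm_sqr h expr0n. Qed.

Lemma enorm_gt0 u : u != 0 -> 0 < enorm u.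
Proof.
move=> u0; rewrite lt_neqAle enorm_ge0 andbT eq_sym.
by apply: contra_neq u0; exact: enorm_eq0.
Qed.

Lemma enormZ a u : enorm (a *: u) = `|a| * enorm u.
Proof. by rewrite /enorm dotZl dotZr mulrA -expr2 sqrtrM ?sqr_ge0 // sqrtr_sqr. Qed.

Lemma enormN u : enorm (- u) = enorm u.
Proof. by rewrite -scaleN1r enormZ normrN1 mul1r. Qed.

Lemma enorm_distC u v : enorm (u - v) = enorm (v - u).
Proof. by rewrite -enormN opprB. Qed.

(** Cauchy-Schwarz, by expanding the square of [enorm v *: u - enorm u *: v] and dividing by
    [enorm u * enorm v]. *)
Lemma dot_le_enorm u v : dot u v <= enorm u * enorm v.
Proof.
have [->|/enorm_gt0 u0] := eqVneq u 0; first by rewrite dot0l enorm0 mul0r.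
have [->|/enorm_gt0 v0] := eqVneq v 0; first by rewrite dot0r enorm0 mulr0.
have := dot_ge0 (enorm v *: u - enorm u *: v).
rewrite !dotE (dotC v u) -!enorm_sqr.
have uv0 : 0 < enorm u * enorm v by rewrite mulr_gt0.
move=> h; rewrite -(ler_pM2l uv0).
by nra.
Qed.

Lemma norm_dot_le u v : `|dot u v| <= enorm u * enorm v.
Proof.
rewrite ler_norml dot_le_enorm andbT lerNl -dotNl.
by rewrite (le_trans (dot_le_enorm _ _)) // enormN.
Qed.

Lemma enormD u v : enorm (u + v) <= enorm u + enorm v.
Proof.
rewrite -(@ler_pXn2r _ 2) ?nnegrE ?addr_ge0 ?enorm_ge0 //.
rewrite enorm_sqr !dotE (dotC v u) sqrrD !enorm_sqr.
by have := dot_le_enorm u v; lra.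
Qed.

Lemma enormB u v : enorm (u - v) <= enorm u + enorm v.
Proof. by rewrite (le_trans (enormD _ _)) // enormN. Qed.

Lemma enorm_triangle w u v : enorm (u - v) <= enorm (u - w) + enorm (w - v).
Proof. by rewrite (le_trans _ (enormD _ _)) // addrA subrK. Qed.

Lemma enorm_subl u v : enorm u - enorm v <= enorm (u + v).
Proof. by rewrite lerBlDr -{1}(addrK v u) enormB. Qed.

Lemma coord_le_enorm u i : `|u 0 i| <= enorm u.
Proof.
rewrite -(@ler_pXn2r _ 2) ?nnegrE ?enorm_ge0 // enorm_sqr real_normK ?num_real //.
rewrite /dot (bigD1 i) //= -expr2 lerDl.
by apply: sumr_ge0 => j _; rewrite -expr2 sqr_ge0.
Qed.

Lemma enorm_le_sum u : enorm u <= \sum_i `|u 0 i|.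
Proof.
rewrite -(@ler_pXn2r _ 2) ?nnegrE ?enorm_ge0 ?sumr_ge0 //.
rewrite enorm_sqr /dot expr2 mulr_suml ler_sum // => i _.
rewrite (le_trans (ler_norm _)) // normrM ler_wpM2l //.
by rewrite (bigD1 i) //= lerDl sumr_ge0.
Qed.

Lemma normr_le_enorm u : `|u| <= enorm u.
Proof.
rewrite [leLHS]mx_normrE; apply: bigmax_le => [|[i j] _] /=.
  exact: enorm_ge0.
by rewrite ord1 coord_le_enorm.
Qed.

Lemma enorm_le_normr u : enorm u <= m%:R * `|u|.
Proof.
rewrite (le_trans (enorm_le_sum u)) //.
apply: sum_ord_le => i; rewrite [leRHS]mx_normrE.
by apply: (@le_bigmax _ _ _ _ (fun ij => `|u ij.1 ij.2|) (0, i)).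
Qed.

End Euclidean.

Lemma dot_mulmx (R : realType) (m n : nat) (u : 'rV[R]_m) (A : 'M[R]_(m, n)) v :
  dot (u *m A) v = dot u (v *m A^T).
Proof. by rewrite !dot_mx trmx_mul trmxK mulmxA. Qed.

Lemma enorm_mulmx_small (R : realType) (m n : nat) (e : R) (A : 'M[R]_(m, n)) u :
  (forall i j, `|A i j| <= e) -> enorm (u *m A) <= (n * m)%:R * e * enorm u.
Proof.
move=> Ae; rewrite (le_trans (enorm_le_sum _)) //.
rewrite -mulrA natrM -mulrA.
apply: sum_ord_le => j; rewrite mxE (le_trans (ler_norm_sum _ _ _)) //.
apply: sum_ord_le => i; rewrite normrM mulrC.
by rewrite ler_pM // ?normr_ge0 ?coord_le_enorm.
Qed.

Lemma enorm_mulmx_le (R : realType) (m n : nat) (A : 'M[R]_(m, n)) :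
  exists2 C : R, 0 < C & forall u, enorm (u *m A) <= C * enorm u.
Proof.
pose e := \sum_i \sum_j `|A i j|.
have e0 : 0 <= e by apply: sumr_ge0 => i _; apply: sumr_ge0.
exists ((n * m)%:R * e + 1); first by rewrite ltr_wpDl // mulr_ge0.
move=> u; rewrite (le_trans (@enorm_mulmx_small _ _ _ e _ _ _)) //.
  move=> i j; rewrite /e (bigD1 i) //= (bigD1 j) //= -addrA lerDl.
  by rewrite addr_ge0 ?sumr_ge0 // => k _; apply: sumr_ge0.
by rewrite ler_wpM2r ?enorm_ge0 // lerDl.
Qed.

(** The sup norm behind the library topology and [enorm] bound each other up to a dimensional
    factor, so the extreme value theorem carries over. Closedness and relative continuity are
    phrased with [enorm] to keep later arguments free of topology. *)
Lemma enorm_EVT_min (R : realType) (m : nat) (K : set 'rV[R]_m) (phi : 'rV[R]_m -> R) (B : R) :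
  K !=set0 -> (forall u, K u -> enorm u <= B) ->
  (forall u, ~ K u -> exists2 d : R, 0 < d & forall v, enorm (v - u) < d -> ~ K v) ->
  (forall u, K u -> forall e : R, 0 < e ->
     exists2 d : R, 0 < d & forall v, K v -> enorm (v - u) < d -> `|phi v - phi u| < e) ->
  exists2 c, K c & forall u, K u -> phi c <= phi u.
Proof.
move=> K0 KB Kc phic.
have nbhs_enorm (u : 'rV[R]_m) (d : R) (P : 'rV[R]_m -> Prop) : 0 < d ->
    (forall v, enorm (v - u) < d -> P v) -> \forall v \near u, P v.
  move=> d0 hP; apply/nbhs_ballP; exists (d / m.+1%:R) => /=; first by rewrite divr_gt0.
  move=> v; rewrite mx_norm_ball /ball_ /= => uv; apply: hP.
  rewrite enorm_distC (le_lt_trans (enorm_le_normr _)) //.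
  rewrite ltr_pdivlMr // in uv; rewrite (le_lt_trans _ uv) // mulrC.
  by rewrite ler_wpM2l // ler_nat.
have compK : compact K.
  apply: bounded_closed_compact.
    exists B; split; first exact: num_real.
    move=> x /ltW Bx u /KB uB.
    exact: le_trans (le_trans (normr_le_enorm u) uB) Bx.
  rewrite -[K]setCK; apply: open_closedC; rewrite openE => u /Kc[d d0 hd].
  exact: (nbhs_enorm _ d).
have contphi : {within K, continuous phi}.
  apply/subspace_continuousP => u Ku; apply/cvgrPdist_lt => e e0.
  have [d d0 hd] := phic u Ku e e0.
  rewrite near_withinE; apply: (nbhs_enorm _ d) => // v vd Kv.
  by rewrite distrC hd.
have [c cK cmin] := EVT_min_rV K0 compK contphi.
exists c; first exact: set_mem.
by move=> u Ku; apply: cmin; apply: mem_set.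
Qed.

Lemma enorm_lipschitz (R : realType) (m : nat) (u v : 'rV[R]_m) :
  `|enorm u - enorm v| <= enorm (u - v).
Proof.
rewrite ler_norml; have := enorm_subl u (- v); have := enorm_subl v (- u).
by rewrite !enormN (enorm_distC v u); lra.
Qed.

(** Replaces the passage to the limit in first-order estimates: a positive [a] is refuted by
    [e = min (1, a / (2 C))]. The restriction [e <= 1] lets callers absorb terms of order [e ^ 2]
    into the constant. *)
Lemma le0_small (R : realType) (a C : R) :
  (forall e, 0 < e -> e <= 1 -> a <= e * C) -> a <= 0.
Proof.
move=> h; rewrite leNgt; apply/negP => a0.
have C0 : 0 < C by have := h 1 ltr01 (lexx 1); lra.
have e0 : 0 < Num.min 1 (a / (2 * C)) by rewrite lt_min ltr01 divr_gt0 // mulr_gt0.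
have := h _ e0; rewrite ge_min lexx => /(_ isT).
have : Num.min 1 (a / (2 * C)) <= a / (2 * C) by rewrite ge_min lexx orbT.
by rewrite ler_pdivlMr ?mulr_gt0 //; lra.
Qed.

Lemma ltr_min2 (R : realType) (a b c : R) : a < Num.min b c -> a < b /\ a < c.
Proof. by rewrite lt_min => /andP. Qed.

(** The Moore-Penrose left inverse of a matrix of full column rank. Derivatives act on row vectors
    from the right, so its rows are orthogonal to the kernel [v *m A = 0], the tangent space in the
    applications. *)
Definition normal_inverse (R : realType) (m n : nat) (A : 'M[R]_(n, m)) : 'M[R]_(m, n) :=
  invmx (A^T *m A) *m A^T.

(** The Gram matrix is invertible: [v *m A^T *m A = 0] forces [v *m A^T] to have norm zero, and the
    rows of [A^T] are independent. *)
Lemma normal_inverseK (R : realType) (m n : nat) (A : 'M[R]_(n, m)) :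
  row_full A -> normal_inverse A *m A = 1%:M.
Proof.
move=> fA; rewrite /normal_inverse -mulmxA mulVmx // -row_free_unit.
apply: inj_row_free => v; rewrite mulmxA => vAA.
have fAt : row_free A^T by rewrite /row_free mxrank_tr.
apply/eqP; rewrite -(mulmx_free_eq0 _ fAt); apply/eqP/dot_eq0.
by rewrite dot_mulmx dotC trmxK vAA dot0l.
Qed.

Lemma dot_normal_inverse (R : realType) (m n : nat) (A : 'M[R]_(n, m)) s v :
  v *m A = 0 -> dot (s *m normal_inverse A) v = 0.
Proof.
by move=> vA; rewrite dot_mulmx trmx_mul trmxK mulmxA vA mul0mx dot0r.
Qed.

(** * Solving the defining equation by a small correction along the rows of [G] *)

Section Solve.
Variables (R : realType) (n m : nat) (F : vec R n -> 'rV[R]_m) (DF : vec R n -> 'M[R]_(n, m)).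
Variables (x0 : vec R n) (r : R) (G : 'M[R]_(m, n)).
Hypotheses (r0 : 0 < r) (F1 : C1_map F DF (Defs.ball x0 r)).
Hypotheses (Fx0 : F x0 = 0) (GA : G *m DF x0 = 1%:M).

Lemma C1_map_cont x : enorm (x - x0) < r -> forall e : R, 0 < e ->
  exists2 d : R, 0 < d & forall y, enorm (y - x) < d -> enorm (F y - F x) < e.
Proof.
move=> xr e e0; have [d [d0 hd]] := F1.1 x xr 1 ltr01.
have [C C0 hC] := enorm_mulmx_le (DF x).
exists (Num.min d (e / (C + 1))); first by rewrite lt_min d0 divr_gt0 // addr_gt0.
move=> y /ltr_min2[/hd yd]; rewrite ltr_pdivlMr ?addr_gt0 //.
have := enormD (F y - F x - (y - x) *m DF x) ((y - x) *m DF x).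
by rewrite subrK; have := hC (y - x); lra.
Qed.

(** Since [G *m DF x0] is the identity, [G *m DF y] stays within one half of it. This yields both
    the descent step of [solve_near] and the invertibility of [G *m DF y] in [rgrad_csub]. *)
Lemma deriv_stable : exists2 d : R, 0 < d & forall y, enorm (y - x0) < d ->
  enorm (y - x0) < r /\
  forall u, enorm (u *m G *m (DF y - DF x0)) <= 2^-1 * enorm u.
Proof.
have [C C0 hC] := enorm_mulmx_le G.
pose N : R := (m * n)%:R.
have N0 : 0 <= N by rewrite ler0n.
(* An entrywise bound costs a factor [N] for the matrix and [C] for [G]; [N + 1] keeps the inverse
   meaningful when [N = 0]. *)
have e0 : 0 < (2 * C * (N + 1))^-1 by rewrite invr_gt0 !mulr_gt0 //; lra.
have x0r : enorm (x0 - x0) < r by rewrite subrr enorm0.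
have [d [d0 hd]] := F1.2 x0 x0r _ e0.
exists (Num.min d r); first by rewrite lt_min d0.
move=> y /ltr_min2[yd yr]; split=> // u.
have h i j : `|(DF y - DF x0) i j| <= (2 * C * (N + 1))^-1.
  by rewrite !mxE ltW // hd.
rewrite (le_trans (enorm_mulmx_small _ h)) // -/N.
have uG := hC u.
apply: (@le_trans _ _ (N * (2 * C * (N + 1))^-1 * (C * enorm u))).
  by rewrite ler_wpM2l // mulr_ge0 // ltW.
have -> : N * (2 * C * (N + 1))^-1 * (C * enorm u) = N / (N + 1) * (2^-1 * enorm u).
  by field; rewrite !gt_eqF //; lra.
rewrite ler_piMl ?mulr_ge0 ?enorm_ge0 ?invr_ge0 //.
by rewrite ler_pdivrMr; lra.
Qed.

(* [s] minimises [|F (x - s G)|] over a ball: the minimum is interior, and at an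
   interior point moving [s] in the direction [F y] decreases [|F|] unless [F y = 0]. *)
Lemma solve_near (rho : R) : 0 < rho ->
  exists2 d : R, 0 < d & forall x, enorm (x - x0) < d ->
    exists2 s, enorm s < rho & F (x - s *m G) = 0.
Proof.
move=> rho0.
have [CA CA0 hCA] := enorm_mulmx_le (DF x0).
have [C C0 hC] := enorm_mulmx_le G.
have [d2 d20 hd2] := deriv_stable.
(* With this slope, [s *m G] contributes at most half of [enorm s] to the linearisation error of
   [F]. *)
have e0 : 0 < (2 * C)^-1 by rewrite invr_gt0 mulr_gt0.
have x0r : enorm (x0 - x0) < r by rewrite subrr enorm0.
have [d1 [d10 hd1]] := F1.1 x0 x0r _ e0.
set e1 := (2 * C)^-1 in e0 hd1.
have eC : e1 * C = 2^-1 by rewrite /e1; field; rewrite gt_eqF.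
pose d := Num.min d1 d2.
have d0 : 0 < d by rewrite lt_min d10.
(* The radius for [s]: below [rho], and such that [x - s *m G] stays where the estimates at [x0]
   hold. *)
pose rh := Num.min (rho / 2) (d / (2 * C)).
have rh0 : 0 < rh by rewrite lt_min !divr_gt0 // mulr_gt0.
have rhd : C * rh <= d / 2.
  have : rh <= d / (2 * C) by rewrite /rh ge_min lexx orbT.
  by rewrite ler_pdivlMr ?mulr_gt0 //; lra.
have rhrho : rh < rho.
  have : rh <= rho / 2 by rewrite /rh ge_min lexx.
  by lra.
have CAe : 0 < 4 * (CA + e1) by lra.
exists (Num.min (d / 2) (rh / (4 * (CA + e1)))).
  by rewrite lt_min !divr_gt0.
move=> x /ltr_min2[xd]; rewrite ltr_pdivlMr // => xrh.
have near s : enorm s <= rh -> enorm (x - s *m G - x0) < d.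
  move=> srh; have := enormB (x - x0) (s *m G); have := hC s.
  have : C * enorm s <= C * rh by rewrite ler_pM2l.
  by rewrite (addrAC x); lra.
have Fest s : enorm s <= rh ->
    enorm (F (x - s *m G) - ((x - x0) *m DF x0 - s)) <= e1 * enorm (x - x0) + 2^-1 * enorm s.
  move=> srh; have [yd1 _] := ltr_min2 (near s srh).
  have := hd1 _ yd1; rewrite Fx0 subr0 (addrAC x) mulmxDl mulNmx -mulmxA GA mulmx1.
  move=> h; apply: (le_trans h); rewrite -eC -mulrA -mulrDr ler_pM2l //.
  by rewrite (le_trans (enormB _ _)) // lerD2l.
have K0 : [set s : 'rV[R]_m | enorm s <= rh] !=set0.
  by exists 0; rewrite /= enorm0 ltW.
have [c cK cmin] : exists2 c, [set s : 'rV[R]_m | enorm s <= rh] c &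
    forall u, [set s : 'rV[R]_m | enorm s <= rh] u ->
      enorm (F (x - c *m G)) <= enorm (F (x - u *m G)).
  apply: (@enorm_EVT_min _ _ _ (fun s => enorm (F (x - s *m G))) rh K0) => //= u.
    move/negP; rewrite -ltNge => uK.
    exists (enorm u - rh); first by rewrite subr_gt0.
    by move=> v; have := enorm_subl u (- v); rewrite enormN enorm_distC; lra.
  move=> uK e ee0.
  have [yr _] := hd2 _ (ltr_min2 (near u uK)).2.
  have [t t0 ht] := C1_map_cont yr ee0.
  exists (t / C); first by rewrite divr_gt0.
  move=> v _; rewrite ltr_pdivlMr // => uv.
  rewrite (le_lt_trans (enorm_lipschitz _ _)) // ht //.
  have -> : x - v *m G - (x - u *m G) = - ((v - u) *m G).
    by rewrite mulmxBl; apply/rowP => i; rewrite !mxE; ring.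
  by rewrite enormN (le_lt_trans (hC _)) // mulrC.
(* On the boundary the linearisation makes [F (x - c *m G)] at least about [rh / 2] in norm, more
   than the value at [s = 0], because [x] is so close to [x0]. *)
have c_int : enorm c < rh.
  rewrite lt_neqAle (cK : is_true (_ <= _)) andbT; apply/eqP => crh.
  have z0 : enorm (0 : 'rV[R]_m) <= rh by rewrite enorm0 ltW.
  have := cmin 0 z0; have := Fest c cK; have := Fest 0 z0.
  rewrite mul0mx !subr0 enorm0.
  have := hCA (x - x0).
  set a := F x; set b := F _; set q := (x - x0) *m _ => hq ha hb.
  have := enormD (a - q) q; rewrite subrK.
  have := enormD (b - (q - c)) (q - b); have := enormB q b.
  have -> : b - (q - c) + (q - b) = c by apply/rowP => i; rewrite !mxE; ring.
  rewrite crh; lra.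
exists c; first by lra.
set y := x - c *m G.
have [yr hy] := hd2 _ (ltr_min2 (near c cK)).2.
rewrite -/y in yr hy; set a := F y.
apply: contrapT => /eqP /enorm_gt0 a0.
have e40 : 0 < (4 * C)^-1 by rewrite invr_gt0 mulr_gt0.
have [t [t0 ht]] := F1.1 y yr _ e40.
(* The three caps keep [1 - tau] nonnegative, the displacement within the range of the linearisation
   at [y], and [c + tau *: a] in the ball. *)
pose tau := Num.min (Num.min 1 (t / (2 * (C * enorm a)))) ((rh - enorm c) / enorm a).
have Ca0 : 0 < C * enorm a by rewrite mulr_gt0.
have tau0 : 0 < tau.
  by rewrite !lt_min ltr01 !divr_gt0 ?subr_gt0 // mulr_gt0.
have tau1 : tau <= 1 by rewrite /tau !ge_min lexx.
have taut : tau * (C * enorm a) < t.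
  have : tau <= t / (2 * (C * enorm a)) by rewrite /tau !ge_min lexx orbT.
  by rewrite ler_pdivlMr ?mulr_gt0 //; lra.
have taur : tau * enorm a <= rh - enorm c.
  have : tau <= (rh - enorm c) / enorm a by rewrite /tau !ge_min lexx orbT.
  by rewrite ler_pdivlMr.
have hs : enorm (c + tau *: a) <= rh.
  by rewrite (le_trans (enormD _ _)) // enormZ gtr0_norm //; lra.
have := cmin _ hs; rewrite leNgt => /negP; apply.
rewrite mulmxDl -scalemxAl opprD addrA -/y -/a.
have haG : enorm (a *m G) <= C * enorm a := hC a.
have e' : enorm (y - tau *: (a *m G) - y) <= tau * (C * enorm a).
  rewrite addrAC subrr add0r enormN enormZ gtr0_norm // ler_pM2l //.
have := ht (y - tau *: (a *m G)) (le_lt_trans e' taut).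
rewrite -/a; set b := F _ => hb.
have {}hb : enorm (b - a - (y - tau *: (a *m G) - y) *m DF y) <= tau * enorm a / 4.
  rewrite (le_trans hb) //.
  apply: (@le_trans _ _ ((4 * C)^-1 * (tau * (C * enorm a)))); first by rewrite ler_pM2l.
  by rewrite le_eqVlt; apply/orP; left; apply/eqP; field; rewrite gt_eqF.
(* The terms have norms at most [tau / 4], [1 - tau] and [tau / 2] times [enorm a], so the new value
   is strictly shorter than [a]. *)
have eq : b = (b - a - (y - tau *: (a *m G) - y) *m DF y) + (1 - tau) *: a
    - tau *: (a *m G *m (DF y - DF x0)).
  have -> : y - tau *: (a *m G) - y = - (tau *: (a *m G)) by rewrite addrAC subrr add0r.
  rewrite mulmxBr -(mulmxA a G (DF x0)) GA mulmx1 mulNmx -scalemxAl.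
  by apply/rowP => i; rewrite !mxE; ring.
rewrite [in ltLHS]eq.
apply: (le_lt_trans (enormB _ _)); apply: (le_lt_trans (lerD (enormD _ _) (lexx _))).
rewrite !enormZ (gtr0_norm tau0) ger0_norm ?subr_ge0 //.
have := hy a => hya.
have : tau * enorm (a *m G *m (DF y - DF x0)) <= tau * (2^-1 * enorm a) by rewrite ler_pM2l.
have : 0 < tau * enorm a by rewrite mulr_gt0.
lra.
Qed.

End Solve.

(** * Tangent vectors as velocities of curves, and normal vectors *)

Section Tangent.
Variables (R : realType) (n : nat) (M : set (vec R n)) (x : vec R n).
Hypothesis Mx : M x.

Lemma local_defn_ball (m : nat) (F : vec R n -> 'rV[R]_m) DF r y :
  local_defn M x F DF r -> enorm (y - x) < r -> row_full (DF y) ->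
  local_defn M y F DF (r - enorm (y - x)).
Proof.
move=> [r0 [[F1 F2] [_ FM]]] yr fy.
have sub z : enorm (z - y) < r - enorm (y - x) -> enorm (z - x) < r.
  by have := enorm_triangle y z x; lra.
split; first by rewrite subr_gt0.
split; last by split=> // z /sub; exact: FM.
split=> z /sub zr e e0; first exact: F1.
by have [d [d0 hd]] := F2 z zr e e0; exists d; split=> // w /sub; exact: hd.
Qed.

(** The point [x + t v] is corrected onto [M] by some [s *m G]. As [v] lies in the kernel of the
    derivative, the linear part of [F] sees only [s], so the correction is of smaller order than
    [t]. *)
Lemma local_defn_curve (m : nat) (F : vec R n -> 'rV[R]_m) DF r v :
  local_defn M x F DF r -> v *m DF x = 0 ->
  forall e : R, 0 < e -> exists2 d : R, 0 < d & forall t, `|t| < d ->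
    exists2 y, M y & enorm (y - x - t *: v) <= e * `|t|.
Proof.
move=> [r0 [F1 [fA FM]]] vA e e0.
have xr : enorm (x - x) < r by rewrite subrr enorm0.
have Fx : F x = 0 by apply/(FM x xr).
have GA := normal_inverseK fA; set G := normal_inverse _ in GA.
have [C C0 hC] := enorm_mulmx_le G.
have v0 := enorm_ge0 v.
(* The first cap absorbs the share of [s] on the right of [enorm s <= eta * enorm (y - x)]; the
   second turns the resulting bound into [e * |t|]. *)
pose eta := Num.min (2 * C)^-1 (e / (2 * C * (enorm v + 1))).
have V0 : 0 < 2 * C * (enorm v + 1) by rewrite !mulr_gt0 //; lra.
have eta0 : 0 < eta by rewrite lt_min invr_gt0 mulr_gt0 //= divr_gt0.
have etaC : eta * C <= 2^-1.
  have : eta <= (2 * C)^-1 by rewrite /eta ge_min lexx.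
  by rewrite -[_^-1]mul1r ler_pdivlMr ?mulr_gt0 //; lra.
have etae : eta * (2 * C * (enorm v + 1)) <= e.
  have : eta <= e / (2 * C * (enorm v + 1)) by rewrite /eta ge_min lexx orbT.
  by rewrite ler_pdivlMr.
have [d1 [d10 hd1]] := F1.1 x xr _ eta0.
pose d := Num.min d1 r.
have d0 : 0 < d by rewrite lt_min d10.
have rho0 : 0 < d / (2 * C) by rewrite divr_gt0 // mulr_gt0.
have [d2 d20 hd2] := solve_near r0 F1 Fx GA rho0.
exists (Num.min (d / (2 * (enorm v + 1))) (d2 / (enorm v + 1))).
  by rewrite lt_min !divr_gt0 ?mulr_gt0 //; lra.
move=> t /ltr_min2[]; rewrite !ltr_pdivlMr ?mulr_gt0 //; try lra.
move=> td td2; have t0 := normr_ge0 t.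
have tv : enorm (t *: v) = `|t| * enorm v by rewrite enormZ.
have [|s srho hs] := hd2 (x + t *: v).
  by rewrite addrAC subrr add0r tv; lra.
have hsG := hC s.
have sd : 2 * (C * enorm s) < d.
  by move: srho; rewrite ltr_pdivlMr ?mulr_gt0 //; lra.
have yE : x + t *: v - s *m G - x = t *: v - s *m G by rewrite addrAC (addrAC x) subrr add0r.
have yd : enorm (x + t *: v - s *m G - x) < d.
  by rewrite yE (le_lt_trans (enormB _ _)) // tv; lra.
have [yd1 yr] := ltr_min2 yd.
exists (x + t *: v - s *m G); first exact/(FM _ yr).
have -> : x + t *: v - s *m G - x - t *: v = - (s *m G).
  by rewrite yE addrAC subrr add0r.
rewrite enormN.
have := hd1 _ yd1; rewrite hs Fx subrr sub0r enormN yE mulmxBl -scalemxAl vA scaler0 sub0r.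
rewrite -mulmxA GA mulmx1 enormN => h.
have := enormB (t *: v) (s *m G); rewrite tv => h2.
have h3 : enorm s <= eta * (`|t| * enorm v) + eta * (C * enorm s).
  rewrite -mulrDr (le_trans h) // ler_pM2l //; lra.
have h4 : eta * C * enorm s <= 2^-1 * enorm s by rewrite ler_wpM2r // enorm_ge0.
have h5 : C * enorm s <= C * (2 * (eta * (`|t| * enorm v))) by rewrite ler_pM2l //; lra.
have h6 : `|t| * (eta * (2 * C * (enorm v + 1))) <= `|t| * e by rewrite ler_wpM2l.
have h7 : 0 <= `|t| * (eta * C) by rewrite !mulr_ge0 // ltW.
lra.
Qed.

Lemma tangent_curve v : tangent M x v ->
  forall e : R, 0 < e -> exists2 d : R, 0 < d & forall t, `|t| < d ->
    exists2 y, M y & enorm (y - x - t *: v) <= e * `|t|.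
Proof. by move=> [m [F [DF [r [ld vA]]]]]; exact: local_defn_curve ld vA. Qed.

(* [tangent] ranges over all local definitions of [M]; they all give the same kernel. *)
Lemma tangent_ker (m : nat) (F : vec R n -> 'rV[R]_m) DF r v :
  local_defn M x F DF r -> tangent M x v -> v *m DF x = 0.
Proof.
move=> [r0 [F1 [_ FM]]] /tangent_curve curve.
have xr : enorm (x - x) < r by rewrite subrr enorm0.
have Fx : F x = 0 by apply/(FM x xr).
have [C C0 hC] := enorm_mulmx_le (DF x).
have v0 := enorm_ge0 v.
apply: enorm_eq0; apply/eqP; rewrite eq_le enorm_ge0 andbT.
(* [F] vanishes at [x] and at a point [y] of [M] near [x + t v], so [(y - x) *m DF x] is of order
   [e t]; replacing [y - x] by [t v] costs [C e t], and [t] cancels. *)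
apply: (@le0_small _ _ (enorm v + 1 + C)) => e e0 e1.
have [d d0 hd] := curve _ e0.
have [d1 [d10 hd1]] := F1.1 x xr _ e0.
pose t := Num.min (d / 2) (Num.min (d1 / (2 * (enorm v + 1))) (r / (2 * (enorm v + 1)))).
have V0 : 0 < 2 * (enorm v + 1) by lra.
have t0 : 0 < t by rewrite !lt_min !divr_gt0.
have td : t <= d / 2 by rewrite /t ge_min lexx.
have td1 : t * (2 * (enorm v + 1)) <= d1.
  by rewrite -ler_pdivlMr // /t !ge_min lexx !orbT.
have tr : t * (2 * (enorm v + 1)) <= r.
  by rewrite -ler_pdivlMr // /t !ge_min lexx !orbT.
have [|y My yt] := hd t; first by rewrite gtr0_norm //; lra.
rewrite gtr0_norm // in yt.
have yx : enorm (y - x) <= t * (enorm v + 1).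
  have := enormD (y - x - t *: v) (t *: v); rewrite subrK enormZ gtr0_norm //.
  have : e * t <= t by rewrite ler_piMl // ltW.
  by lra.
have tv0 : 0 < t * (enorm v + 1) by rewrite mulr_gt0 //; lra.
have yr : enorm (y - x) < r by lra.
have := hd1 y; rewrite Fx ((FM y yr).1 My) subrr sub0r enormN => /(_ _) h.
have {}h : enorm ((y - x) *m DF x) <= e * (t * (enorm v + 1)).
  by rewrite (le_trans (h _)) ?ler_pM2l //; lra.
have := hC (y - x - t *: v); have := enormB ((y - x) *m DF x) ((y - x - t *: v) *m DF x).
rewrite -mulmxBl opprB addrC subrK -scalemxAl enormZ gtr0_norm //.
have : C * enorm (y - x - t *: v) <= C * (e * t) by rewrite ler_pM2l.
by move=> h1 h2 h3; rewrite -(ler_pM2l t0); lra.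
Qed.

Lemma normal_inverse_normal (m : nat) (F : vec R n -> 'rV[R]_m) DF r s :
  local_defn M x F DF r -> normal M x (s *m normal_inverse (DF x)).
Proof. by move=> ld v /(tangent_ker ld); exact: dot_normal_inverse. Qed.

End Tangent.

(** * Convex subgradients and their agreement with the limiting ones *)

Definition csub (R : realType) (n : nat) (f : vec R n -> \bar R) (x : vec R n) : set (vec R n) :=
  [set v | f x \is a fin_num /\ forall y, (f x + (dot v (y - x))%:E <= f y)%E].

Section Subgradient.
Variables (R : realType) (n : nat) (f : vec R n -> \bar R).
Hypotheses (fp : proper_fun f) (fc : convex_fun f).

Lemma proper_fin x (r : R) : (f x <= r%:E)%E -> f x \is a fin_num.
Proof. by move=> h; rewrite fin_numE fp.1 -ltey (le_lt_trans h) ?ltry. Qed.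

Lemma csub_real x v y : csub f x v -> f y \is a fin_num ->
  fine (f x) + dot v (y - x) <= fine (f y).
Proof.
by move=> [fx h] fy; have := h y; rewrite -(fineK fx) -(fineK fy) -EFinD lee_fin.
Qed.

Lemma csub_intro x v : f x \is a fin_num ->
  (forall y, f y \is a fin_num -> fine (f x) + dot v (y - x) <= fine (f y)) -> csub f x v.
Proof.
move=> fx h; split=> // y; have [fy|] := boolP (f y \is a fin_num).
  by rewrite -(fineK fx) -(fineK fy) -EFinD lee_fin h.
by rewrite fin_numE fp.1 /= negbK => /eqP ->; rewrite leey.
Qed.

Lemma csub_frechet x v : csub f x v -> frechet_sub f x v.
Proof.
move=> [fx h]; split=> // e e0; exists 1; split=> // y _.
rewrite (le_trans _ (h y)) // leeD2l // lee_fin gerBl.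
by rewrite mulr_ge0 ?enorm_ge0 // ltW.
Qed.

(** Convexity makes the local inequality global: compare it with the chord at [x + t (y - x)],
    divide by [t], and let [e] tend to zero. *)
Lemma frechet_csub x v : frechet_sub f x v -> csub f x v.
Proof.
move=> [fx h]; apply: csub_intro => // y fy; rewrite -subr_le0.
apply: (@le0_small _ _ (enorm (y - x))) => e e0 _.
have [d [d0 hd]] := h e e0.
pose t := Num.min 1 (d / (2 * (enorm (y - x) + 1))).
have N0 := enorm_ge0 (y - x).
have V0 : 0 < 2 * (enorm (y - x) + 1) by lra.
have t0 : 0 < t by rewrite lt_min ltr01 divr_gt0.
have t1 : t <= 1 by rewrite /t ge_min lexx.
have td : t * (2 * (enorm (y - x) + 1)) <= d.
  by rewrite -ler_pdivlMr // /t ge_min lexx orbT.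
have zE : t *: y + (1 - t) *: x - x = t *: (y - x).
  by apply/rowP => i; rewrite !mxE; ring.
have := hd (t *: y + (1 - t) *: x); rewrite zE enormZ gtr0_norm //.
have tN0 : 0 <= t * enorm (y - x) by rewrite mulr_ge0 // ltW.
move=> /(_ _) h1.
have t01 : 0 <= t <= 1 by rewrite (ltW t0).
have tN : t * enorm (y - x) < d by lra.
have := le_trans (h1 tN) (fc fy fx t01).
rewrite -[f x in leLHS](fineK fx) -EFinD lee_fin dotZr => h2.
by rewrite -(ler_pM2l t0); lra.
Qed.

(** The global subgradient inequality passes to the limit along the defining sequences; conversely
    constant sequences suffice. *)
Lemma lim_subE x : lim_sub f x = csub f x.
Proof.
apply/seteqP; split=> v.
  move=> [xs [vs [hs [xsx [vsv fs]]]]].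
  have fx : f x \is a fin_num.
    have [N hN] := fs 1 ltr01; have := hN N (leqnn N).
    have [fxN _] := hs N; rewrite -(fineK fxN).
    by case: (f x).
  apply: csub_intro => // y fy; rewrite -subr_le0.
  (* The summands account in turn for the error in the value of [f], in the subgradient, in the
     product of both displacements, and in the base point. *)
  apply: (@le0_small _ _ (1 + enorm (y - x) + 1 + enorm v)) => e e0 e1.
  have [N1 h1] := fs e e0; have [N2 h2] := xsx e e0; have [N3 h3] := vsv e e0.
  pose k := maxn N1 (maxn N2 N3).
  have {}h1 := h1 k (leq_maxl _ _).
  have {}h2 := h2 k (leq_trans (leq_maxl _ _) (leq_maxr _ _)).
  have {}h3 := h3 k (leq_trans (leq_maxr _ _) (leq_maxr _ _)).
  have ck := frechet_csub (hs k).
  have := csub_real ck fy.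
  move: h1; rewrite -(fineK ck.1) -(fineK fx) -EFinB abse_EFin lte_fin !fineK //; last exact: ck.1.
  rewrite ltr_norml => /andP[h1 _].
  have -> : dot (vs k) (y - xs k) = dot (vs k - v) (y - x) - dot (vs k - v) (xs k - x)
      + dot v (y - x) - dot v (xs k - x) by rewrite !dotBl !dotBr; ring.
  have := norm_dot_le (vs k - v) (y - x); have := norm_dot_le (vs k - v) (xs k - x).
  have := norm_dot_le v (xs k - x).
  rewrite !ler_norml => /andP[_ a1] /andP[_ a2] /andP[a3 _].
  have n0 := enorm_ge0 v; have n1 := enorm_ge0 (y - x).
  have n2 := enorm_ge0 (vs k - v); have n3 := enorm_ge0 (xs k - x).
  have b1 : enorm v * enorm (xs k - x) <= enorm v * e by rewrite ler_wpM2l // ltW.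
  have b2 : enorm (vs k - v) * enorm (xs k - x) <= e * 1.
    by rewrite ler_pM // ?(ltW h3) // (le_trans (ltW h2)).
  have b3 : enorm (vs k - v) * enorm (y - x) <= e * enorm (y - x).
    by rewrite ler_wpM2r // ltW.
  lra.
move=> cv; exists (fun=> x), (fun=> v); split; first by move=> _; exact: csub_frechet.
split; first by move=> e e0; exists 0%N => k _; rewrite subrr enorm0.
split; first by move=> e e0; exists 0%N => k _; rewrite subrr enorm0.
move=> e e0; exists 0%N => k _; rewrite subee ?cv.1 //.
by rewrite abse0 lte_fin.
Qed.

Lemma argmin_csub x : f x \is a fin_num -> argmin f x -> csub f x 0.
Proof. by move=> fx h; split=> // y; rewrite dot0l adde0. Qed.

Lemma csub_monotone x y v w : csub f x v -> csub f y w -> 0 <= dot (v - w) (x - y).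
Proof.
move=> cv cw; have := csub_real cv cw.1; have := csub_real cw cv.1.
by rewrite -[y - x]opprB dotNr dotBl; lra.
Qed.

Lemma csub_convex x v w (t : R) : 0 <= t -> t <= 1 -> csub f x v -> csub f x w ->
  csub f x (v + t *: (w - v)).
Proof.
move=> t0 t1 cv cw; apply: csub_intro (cv.1) _ => y fy.
have := csub_real cv fy; have := csub_real cw fy.
rewrite dotDl dotZl dotBl; set a := dot w _; set b := dot v _.
by move=> h1 h2; nra.
Qed.

(** A subgradient inequality violated at some [y] by a positive gap remains violated for all vectors
    within the gap divided by [enorm (y - x) + 1]. *)
Lemma csub_closed x v : f x \is a fin_num -> ~ csub f x v ->
  exists2 d : R, 0 < d & forall w, enorm (w - v) < d -> ~ csub f x w.
Proof.
move=> fx ncv.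
have [y [fy hy]] : exists y, f y \is a fin_num /\ fine (f y) < fine (f x) + dot v (y - x).
  apply: contrapT => h; apply: ncv; apply: csub_intro => // y fy.
  by rewrite leNgt; apply/negP => lt; apply: h; exists y.
have N0 := enorm_ge0 (y - x).
have g0 : 0 < fine (f x) + dot v (y - x) - fine (f y) by rewrite subr_gt0.
exists ((fine (f x) + dot v (y - x) - fine (f y)) / (enorm (y - x) + 1)).
  by rewrite divr_gt0 //; lra.
move=> w; rewrite ltr_pdivlMr; last by lra.
move=> wv cw; have := csub_real cw fy.
have := dot_le_enorm (v - w) (y - x); rewrite dotBl enorm_distC.
by have := enorm_ge0 (w - v); nra.
Qed.

(** On [M] the function is [g], so along a curve in [M] with velocity [u] the subgradient inequality
    bounds [dot (Dg x - v) u] from one side up to a small error; the opposite direction gives the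
    other side. *)
Lemma csub_normal M x v r g Dg : M x -> csub f x v ->
  smooth_ext f M x r g Dg -> normal M x (Dg x - v).
Proof.
move=> Mx cv [r0 [[g1 _] fg]] u tu.
have xr : enorm (x - x) < r by rewrite subrr enorm0.
set D := Dg x - v; have D0 := enorm_ge0 D; have u0 := enorm_ge0 u.
apply/eqP; rewrite -normr_le0.
apply: (@le0_small _ _ (enorm u + 1 + enorm D)) => e e0 e1.
have [d d0 hd] := tangent_curve Mx tu e0.
have [d1 [d10 hd1]] := g1 x xr _ e0.
pose t := Num.min (d / 2) (Num.min (d1 / (2 * (enorm u + 1))) (r / (2 * (enorm u + 1)))).
have V0 : 0 < 2 * (enorm u + 1) by lra.
have t0 : 0 < t by rewrite !lt_min !divr_gt0.
have td : t <= d / 2 by rewrite /t ge_min lexx.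
have td1 : t * (2 * (enorm u + 1)) <= d1.
  by rewrite -ler_pdivlMr // /t !ge_min lexx !orbT.
have tr : t * (2 * (enorm u + 1)) <= r.
  by rewrite -ler_pdivlMr // /t !ge_min lexx !orbT.
have tu0 : 0 < t * (enorm u + 1) by rewrite mulr_gt0 //; lra.
(* Stated for both signs of [s], to be used at [t] and at [- t]. *)
have key s : `|s| = t -> - (e * (enorm u + 1 + enorm D) * t) <= s * dot D u.
  move=> st; have [|y My yt] := hd s; first by rewrite st; lra.
  rewrite st in yt.
  have yx : enorm (y - x) <= t * (enorm u + 1).
    have := enormD (y - x - s *: u) (s *: u); rewrite subrK enormZ st.
    have : e * t <= t by rewrite ler_piMl // ltW.
    by lra.
  have fy : f y = (g y)%:E by apply: fg => //; lra.
  have fx : f x = (g x)%:E by exact: fg.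
  have := csub_real cv (y := y); rewrite fy fx /= => /(_ isT) h1.
  have := hd1 y; rewrite ler_norml => /(_ _) h2.
  have /andP[_ {}h2] : - (e * enorm (y - x)) <= g y - g x - dot (Dg x) (y - x) <= e * enorm (y - x).
    by apply: h2; lra.
  have h3 : e * enorm (y - x) <= e * (t * (enorm u + 1)) by rewrite ler_pM2l.
  have := norm_dot_le D (y - x - s *: u).
  rewrite ler_norml => /andP[_]; rewrite dotBr dotZr.
  have : enorm D * enorm (y - x - s *: u) <= enorm D * (e * t) by rewrite ler_wpM2l.
  have : dot D (y - x) = dot (Dg x) (y - x) - dot v (y - x) by rewrite dotBl.
  by lra.
have k1 := key t (gtr0_norm t0).
have := key (- t); rewrite normrN gtr0_norm // => /(_ erefl) k2.
by rewrite -(ler_pM2l t0) -{1}(gtr0_norm t0) -normrM ler_norml; lra.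
Qed.

End Subgradient.

(** * Consequences of partial smoothness and of zero in the relative interior *)

Lemma min_radius (R : realType) (m : nat) (P : 'I_m -> R -> Prop) :
  (forall j d d', d <= d' -> P j d' -> P j d) ->
  (forall j, exists2 d, 0 < d & P j d) -> exists2 d, 0 < d & forall j, P j d.
Proof.
move=> mono h.
have /choice[d hd] : forall j, exists d, 0 < d /\ P j d.
  by move=> j; have [d d0 Pd] := h j; exists d.
(* The default [1] keeps the radius positive for an empty family. *)
exists (\big[Num.min/1]_j d j).
  by apply/bigmin_gtP; split=> [|j _]; [exact: ltr01|exact: (hd j).1].
by move=> j; apply: mono (hd j).2; apply: bigmin_le.
Qed.

Section PartlySmooth.
Variables (R : realType) (n : nat) (f : vec R n -> \bar R) (M : set (vec R n)).
Hypotheses (fp : proper_fun f) (fc : convex_fun f).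

(** A nearest point exists because the subdifferential may be cut to the ball about [w] through a
    known element. Moving from [p] towards [v] by a small [e] cannot shorten the distance, which is
    the variational inequality. *)
Lemma csub_proj x w : csub f x !=set0 ->
  exists2 p, csub f x p & forall v, csub f x v -> dot (w - p) (v - p) <= 0.
Proof.
move=> [v0 cv0].
have [||u|u _ e e0|p [cp pv0] pmin] := @enorm_EVT_min R n
    [set v | csub f x v /\ enorm (v - w) <= enorm (v0 - w)]
    (fun v => enorm (v - w)) (enorm w + enorm (v0 - w)).
- by exists v0.
- move=> u [_ uw]; have := enormD (u - w) w; rewrite subrK.
  by move: uw; set a := enorm (u - w); lra.
- move/not_andP => [nu|/negP]; first have [d d0 hd] := csub_closed fp cv0.1 nu.
    by exists d => // v /hd nv [].
  rewrite -ltNge => uw; exists (enorm (u - w) - enorm (v0 - w)); first by rewrite subr_gt0.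
  move=> v uv [_ vw]; have := enorm_triangle v u w; rewrite (enorm_distC u v).
  by lra.
- exists e => // v _; apply: le_lt_trans; rewrite (le_trans (enorm_lipschitz _ _)) //.
  by rewrite opprB addrA subrK.
have {}pmin v : csub f x v -> enorm (p - w) <= enorm (v - w).
  move=> cv; have [vv0|/ltW vv0] := leP (enorm (v - w)) (enorm (v0 - w)).
    exact: pmin.
  exact: le_trans vv0.
exists p => // v cv.
apply: (@le0_small _ _ (enorm (v - p) ^+ 2)) => e e0 e1.
have := pmin _ (csub_convex fp (ltW e0) e1 cp cv).
rewrite -(@ler_pXn2r _ 2) ?nnegrE ?enorm_ge0 // addrAC -[w - p]opprB !enorm_sqr.
move: (p - w) (v - p) => q u.
rewrite !dotE (dotC u q); have h1 := mulr_ge0 (sqr_ge0 e) (dot_ge0 u).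
by move=> h2; rewrite -(ler_pM2l e0); lra.
Qed.

Lemma rgrad_normal x v w : M x -> csub f x v -> rgrad f M x w -> normal M x (v - w).
Proof.
move=> Mx cv [r [g [Dg [ext [tw nw]]]]] u tu.
have := csub_normal Mx cv ext tu; have := nw u tu.
by rewrite !dotBl; lra.
Qed.

(** The gradient [w] is tangent and [v - w] is normal, so [w] is the orthogonal projection of [v] on
    the tangent space. *)
Lemma rgrad_le x v w : M x -> csub f x v -> rgrad f M x w -> enorm w <= enorm v.
Proof.
move=> Mx cv gw; have := rgrad_normal Mx cv gw.
have [r [g [Dg [_ [tw _]]]]] := gw; move=> /(_ _ tw).
rewrite dotBl -enorm_sqr => h; have := dot_le_enorm v w.
have := enorm_ge0 w; have := enorm_ge0 v.
have [->|/enorm_gt0 w0] := eqVneq w 0; first by rewrite enorm0.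
by move=> _ _ h2; rewrite -(ler_pM2r w0); lra.
Qed.

(** Subtracting [D *m DF x *m normal_inverse (DF x)] removes exactly the normal component of the
    ambient gradient [D]. *)
Lemma rgrad_exists x : C1_submanifold M -> partly_smooth_at f M x -> exists w, rgrad f M x w.
Proof.
move=> sM [Mx [_ [[r [g [Dg ext]]] _]]].
have [m [F [DF [r' ld]]]] := sM x Mx.
set D := Dg x; pose q := D *m DF x *m normal_inverse (DF x).
exists (D - q), r, g, Dg; split=> //; split.
  exists m, F, DF, r'; split=> //.
  by rewrite mulmxBl /q -(mulmxA (D *m _)) normal_inverseK ?mulmx1 ?subrr //; case: ld => _ [_ []].
by rewrite -/D opprB addrC subrK; exact: (normal_inverse_normal Mx (D *m DF x) ld).
Qed.

Variable xbar : vec R n.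
Hypotheses (ps : partly_smooth_at f M xbar) (ri0 : ri (lim_sub f xbar) (0 : vec R n)).

(** The sequential condition in epsilon-delta form: failure would provide points of [M] within
    [1 / (k + 1)] of [xbar] whose subgradients all stay away from [v]. *)
Lemma csub_inner_semicontinuous v : csub f xbar v -> forall e : R, 0 < e ->
  exists2 d : R, 0 < d & forall x, M x -> enorm (x - xbar) < d ->
    exists2 w, csub f x w & enorm (w - v) < e.
Proof.
move=> cv e e0; apply: contrapT => no.
have /choice[xs hxs] : forall k : nat, exists x, M x /\ enorm (x - xbar) < k.+1%:R^-1 /\
    forall w, csub f x w -> ~ enorm (w - v) < e.
  move=> k; apply: contrapT => nk; apply: no; exists k.+1%:R^-1 => // x Mx xk.
  apply: contrapT => nw; apply: nk; exists x; split=> //; split=> // w cw we.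
  by apply: nw; exists w.
have [_ [_ [_ [_ isc]]]] := ps.
have xsx : seq_cvg xs xbar.
  move=> d d0; exists (Num.bound d^-1) => k Nk.
  rewrite (lt_trans (hxs k).2.1) // invf_plt ?posrE //.
  rewrite (lt_le_trans (archi_boundP _)) ?invr_ge0 ?(ltW d0) //.
  by rewrite ler_nat ltnW.
have cv' : lim_sub f xbar v by rewrite lim_subE.
have [ys [N [hN ysv]]] := isc v cv' xs (fun k => (hxs k).1) xsx.
have [N' hN'] := ysv e e0.
have := hN (maxn N N') (leq_maxl _ _); rewrite lim_subE // => /(hxs _).2.2; apply.
exact/hN'/leq_maxr.
Qed.

Variables (m : nat) (F : vec R n -> 'rV[R]_m) (DF : vec R n -> 'M[R]_(n, m)) (r : R).
Hypothesis ld : local_defn M xbar F DF r.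
Let G := normal_inverse (DF xbar).

Let GA : G *m DF xbar = 1%:M.
Proof. by apply: normal_inverseK; case: ld => _ [_ []]. Qed.

(* [0] lies in the relative interior and [par] is the normal space, so small multiples of
   the rows of [G], which span the normal space, are subgradients at [xbar]; inner
   semicontinuity transports this finite family to nearby points of [M]. *)
Lemma uniform_support (C : R) : exists d c : R, [/\ 0 < d, 0 < c &
  forall y, M y -> enorm (y - xbar) < d -> forall z s,
    enorm z <= 1 -> dot z (s *m G) = 1 -> enorm s <= C ->
    exists2 w, csub f y w & c <= dot w z].
Proof.
have [_ [_ [_ [parN _]]]] := ps.
have [c00 [e [e0 he]]] := ri0.
pose B := \sum_j enorm (row j G).
have B0 : 0 <= B by apply: sumr_ge0 => j _; exact: enorm_ge0.
(* Every row of [G] has norm at most [B], so its multiples by [c] and [- c] are shorter than [e]. *)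
pose c := e / (B + 1).
have c0 : 0 < c by rewrite divr_gt0 //; lra.
(* A pigeonhole constant: if every [dot (row j G) z] were below [kappa] in absolute value,
   [dot z (s *m G)] would be at most [m / (m + 1)], not [1]. *)
pose kappa : R := (m.+1%:R * (`|C| + 1))^-1.
have m0 : 0 < m.+1%:R :> R by rewrite ltr0n.
have C0 : 0 <= `|C| by [].
have k0 : 0 < kappa by rewrite invr_gt0 mulr_gt0 //; lra.
have crow (a : R) j : `|a| = c -> csub f xbar (a *: row j G).
  move=> ac; rewrite -(lim_subE fp fc) -[_ *: _]add0r; apply: he.
    rewrite parN rowE scalemxAl; exact: (normal_inverse_normal ps.1 (a *: delta_mx 0 j) ld).
  rewrite enormZ ac /c mulrAC ltr_pdivrMr; last by lra.
  rewrite ltr_pM2l // /B (bigD1 j) //= -addrA ltrDl.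
  by rewrite ltr_wpDl // sumr_ge0 // => i _; exact: enorm_ge0.
have eta0 : 0 < c * kappa / 2 by rewrite divr_gt0 // mulr_gt0.
have [d d0 hd] : exists2 d : R, 0 < d & forall j, forall y, M y -> enorm (y - xbar) < d ->
    forall a, `|a| = c -> exists2 w, csub f y w & enorm (w - a *: row j G) < c * kappa / 2.
  apply: min_radius => [j d d' dd' h y My yd|j].
    exact: h (lt_le_trans yd dd').
  have cN : `|- c| = c by rewrite normrN gtr0_norm.
  have [d1 d10 h1] := csub_inner_semicontinuous (crow c j (gtr0_norm c0)) eta0.
  have [d2 d20 h2] := csub_inner_semicontinuous (crow (- c) j cN) eta0.
  exists (Num.min d1 d2); first by rewrite lt_min d10.
  move=> y My /ltr_min2[yd1 yd2] a /eqP; rewrite eqr_norml ltW // andbT.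
  by case/orP => /eqP ->; [exact: h1|exact: h2].
exists d, (c * kappa / 2); split=> // y My yd z s z1 zs sC.
have [j hj] : exists j, kappa <= `|dot (row j G) z|.
  apply: contrapT => no.
  have : dot z (s *m G) <= m%:R * ((`|C| + 1) * kappa).
    rewrite dotC dot_mulmx; apply: sum_ord_le => j.
    rewrite (le_trans (ler_norm _)) // normrM ler_pM //.
      rewrite (le_trans (coord_le_enorm _ _)) // (le_trans sC) //.
      by rewrite (le_trans (ler_norm _)) // lerDl.
    have -> : (z *m G^T) 0 j = dot (row j G) z.
      by rewrite mxE; apply: eq_bigr => i _; rewrite !mxE mulrC.
    by rewrite ltW // ltNge; apply/negP => h; apply: no; exists j.
  have -> : (`|C| + 1) * kappa = m.+1%:R^-1.
    by rewrite /kappa invfM mulrCA mulfV ?mulr1 // gt_eqF //; lra.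
  rewrite zs.
  by rewrite leNgt ltr_pdivrMr // mul1r ltr_nat ltnSn.
(* The sign is chosen so that [a *: row j G] has component at least [c * kappa] along [z]; the
   approximation by [w] loses at most half of it. *)
pose a : R := if 0 <= dot (row j G) z then c else - c.
have ac : `|a| = c by rewrite /a; case: ifP => _; rewrite ?normrN gtr0_norm.
have [w cw wa] := hd j y My yd a ac.
exists w => //.
have az : a * dot (row j G) z = c * `|dot (row j G) z|.
  by rewrite /a; case: (leP 0 (dot (row j G) z)) => h; [rewrite ger0_norm|rewrite ltr0_norm // mulNr mulrN].
have := norm_dot_le (w - a *: row j G) z.
rewrite ler_norml dotBl dotZl az => /andP[h _].
have : enorm (w - a *: row j G) * enorm z <= c * kappa / 2 * 1.
  by rewrite ler_pM ?enorm_ge0 // ltW.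
have : c * kappa <= c * `|dot (row j G) z| by rewrite ler_pM2l.
lra.
Qed.

(* If [x] is off [M], write [x - y = s G] with [y] in [M]: this is a nonzero normal vector at
   [xbar], so some subgradient at [y] has a component at least [c] along it, and monotonicity
   forces the same for every subgradient at [x]. *)
Lemma identification : exists d c : R, [/\ 0 < d, 0 < c &
  forall x v, enorm (x - xbar) < d -> csub f x v -> enorm v < c -> M x].
Proof.
have [r0 [F1 [_ FM]]] := ld.
have Mxb : M xbar by case: ps.
have xr : enorm (xbar - xbar) < r by rewrite subrr enorm0.
have Fx : F xbar = 0 by apply/(FM _ xr).
have [CA CA0 hCA] := enorm_mulmx_le (DF xbar).
have [C C0 hC] := enorm_mulmx_le G.
have [dK [c [dK0 c0 hK]]] := uniform_support CA.
pose d := Num.min dK r.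
have d0 : 0 < d by rewrite lt_min dK0.
have rho0 : 0 < d / (2 * C) by rewrite divr_gt0 // mulr_gt0.
have [ds ds0 hs] := solve_near r0 F1 Fx GA rho0.
exists (Num.min ds (d / 2)), c; split=> //; first by rewrite lt_min ds0 divr_gt0.
move=> x v /ltr_min2[/hs[s srho Fy] xd] cv vc.
set y := x - s *m G in Fy.
have yd : enorm (y - xbar) < d.
  move: srho; rewrite ltr_pdivlMr ?mulr_gt0 // => srho.
  have := enormB (x - xbar) (s *m G); have := hC s.
  by rewrite /y (addrAC x); lra.
have [ydK yr] := ltr_min2 yd.
have My : M y by apply/(FM _ yr).
have [sG0|sG0] := eqVneq (s *m G) 0; first by move: My; rewrite /y sG0 subr0.
have N0 := enorm_gt0 sG0; set N := enorm _ in N0.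
have NV0 : 0 < N^-1 by rewrite invr_gt0.
pose z := N^-1 *: (s *m G).
have z1 : enorm z = 1 by rewrite enormZ gtr0_norm // mulVf // gt_eqF.
have [|||w cw wz] := hK y My ydK z (N^-1 *: s).
- by rewrite z1.
- by rewrite -scalemxAl -/z -enorm_sqr z1 expr1n.
(* Multiplying [s *m G] by [DF xbar] recovers [s], whence the bound [CA] on the normalised
   coefficients. *)
- rewrite enormZ gtr0_norm // mulrC ler_pdivrMr //.
  by have := hCA (s *m G); rewrite -mulmxA GA mulmx1.
have := csub_monotone cv cw.
have -> : x - y = N *: z.
  rewrite /z scalerA mulfV ?gt_eqF // scale1r /y opprB addrC subrK //.
rewrite dotZr pmulr_rge0 // dotBl => h.
have := dot_le_enorm v z; rewrite z1 mulr1; lra.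
Qed.

(* If not, the direction [z] from the projection of [w] on the subdifferential towards [w] is
   normal to [M] at [x], and every subgradient has a negative component along it. *)
Lemma rgrad_csub : exists2 d : R, 0 < d & forall x w, M x -> enorm (x - xbar) < d ->
  csub f x !=set0 -> rgrad f M x w -> csub f x w.
Proof.
have [r0 [F1 [_ FM]]] := ld.
have xr : enorm (xbar - xbar) < r by rewrite subrr enorm0.
have [CA CA0 hCA] := enorm_mulmx_le (DF xbar).
have [d1 d10 hd1] := deriv_stable G r0 F1.
have [d2 [d20 hd2]] := F1.2 xbar xr _ ltr01.
(* The coefficients [s] below will satisfy [enorm s <= CA + m n + enorm s / 2]. *)
pose C := 2 * (CA + (m * n)%:R).
have [dK [c [dK0 c0 hK]]] := uniform_support C.
exists (Num.min (Num.min d1 d2) dK); first by rewrite !lt_min d10 d20.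
move=> x w Mx /ltr_min2[/ltr_min2[/hd1[xbr stab] xd2] xdK] ne gw.
set B := DF x in stab.
have Bent i j : `|(B - DF xbar) i j| <= 1 by rewrite !mxE ltW // hd2.
have GBE u : u *m (G *m B) = u + u *m G *m (B - DF xbar).
  by rewrite mulmxBr -[u *m G *m DF xbar]mulmxA GA mulmx1 mulmxA addrC subrK.
have GBu : G *m B \in unitmx.
  rewrite -row_free_unit; apply: inj_row_free => u; rewrite GBE => u0.
  apply: enorm_eq0; have := stab u; have := enorm_ge0 u.
  have -> : u *m G *m (B - DF xbar) = - u by apply/eqP; rewrite -addr_eq0 addrC u0.
  by rewrite enormN; lra.
have fB : row_full B.
  by apply/row_fullP; exists (invmx (G *m B) *m G); rewrite -mulmxA mulVmx.
have ldx := local_defn_ball ld xbr fB.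
have [p cp hp] := csub_proj w ne.
have [wp|wp] := eqVneq (w - p) 0; first by rewrite (subr0_eq wp).
have N0 := enorm_gt0 wp; set N := enorm _ in N0.
have NV0 : 0 < N^-1 by rewrite invr_gt0.
pose z := N^-1 *: (w - p).
have z1 : enorm z = 1 by rewrite enormZ gtr0_norm // mulVf // gt_eqF.
have zz : dot z z = 1 by rewrite -enorm_sqr z1 expr1n.
have nz : normal M x z.
  move=> u tu; have := rgrad_normal Mx cp gw tu.
  by rewrite /z dotZl -[w - p]opprB dotNl => ->; rewrite oppr0 mulr0.
(* With this [s] the vector [z - s *m G] is killed by [B = DF x], hence tangent at [x] and
   orthogonal to the normal vector [z]. This gives [dot z (s *m G) = 1] although the rows of [G] are
   normal at [xbar] and not at [x]. *)
pose s := z *m B *m invmx (G *m B).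
have sGB : s *m (G *m B) = z *m B by rewrite mulmxKV.
have zs : dot z (s *m G) = 1.
  have : dot z (z - s *m G) = 0.
    apply: nz; exists m, F, DF, (r - enorm (x - xbar)); split=> //.
    by rewrite mulmxBl -mulmxA sGB subrr.
  by rewrite dotBr zz; lra.
have sC : enorm s <= C.
  have sE : s = z *m DF xbar + z *m (B - DF xbar) - s *m G *m (B - DF xbar).
    by rewrite -mulmxDr (addrC (DF xbar)) subrK -sGB GBE addrK.
  have := stab s; have := hCA z; have := enorm_mulmx_small z Bent.
  have := enormB (z *m DF xbar + z *m (B - DF xbar)) (s *m G *m (B - DF xbar)).
  have := enormD (z *m DF xbar) (z *m (B - DF xbar)).
  by rewrite -sE z1 /C !mulr1; lra.
have [|v cv vz] := hK x Mx xdK z s _ zs sC; first by rewrite z1.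
(* As [w] is tangent, [dot z p = - N]; the projection inequality then gives [dot z v <= - N < 0],
   against [c <= dot v z]. *)
have zw : dot z w = 0 by apply: nz; have [? [? [? [_ []]]]] := gw.
have zp : dot z (w - p) = N.
  by rewrite /z dotZl -enorm_sqr -/N expr2 mulrA mulVf ?mul1r // gt_eqF.
have : dot z (v - p) <= 0 by rewrite /z dotZl pmulr_rle0 // hp.
by move: zp; rewrite !dotBr zw (dotC z v); lra.
Qed.

End PartlySmooth.

(** * Distances to sets *)

Section Dist.
Variables (R : realType) (n : nat).
Implicit Types (x : vec R n) (A : set (vec R n)).

Lemma dist_le x A a : A a -> (Defs.dist x A <= (enorm (x - a))%:E)%E.
Proof. by move=> Aa; apply: ereal_inf_lbound; exists a. Qed.

Lemma le_dist x A c : (forall a, A a -> (c <= (enorm (x - a))%:E)%E) -> (c <= Defs.dist x A)%E.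
Proof. by move=> h; apply: le_ereal_inf_tmp => _ [a Aa <-]; exact: h. Qed.

Lemma dist_ge0 x A : (0 <= Defs.dist x A)%E.
Proof. by apply: le_dist => a _; rewrite lee_fin enorm_ge0. Qed.

Lemma le_dist_subset x A B : A `<=` B -> (Defs.dist x B <= Defs.dist x A)%E.
Proof. by move=> AB; apply: le_dist => a /AB; exact: dist_le. Qed.

(** A point [b] of [A] farther from [x] than [a] may be replaced by [a]; any other lies within
    [2 * enorm (x - a) < d] of [a] and so belongs to [B]. *)
Lemma dist_setI x A B a d : A a -> B a -> (forall b, enorm (b - a) < d -> A b -> B b) ->
  2 * enorm (x - a) < d -> (Defs.dist x (A `&` B) <= Defs.dist x A)%E.
Proof.
move=> Aa Ba AB xd; apply: le_dist => b Ab.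
have [xb|xb] := leP (enorm (x - a)) (enorm (x - b)).
  by rewrite (le_trans (dist_le x (conj Aa Ba))) // lee_fin.
apply: dist_le; split=> //; apply: AB => //.
by have := enorm_triangle x b a; rewrite (enorm_distC b x); lra.
Qed.

End Dist.

(** * The equivalence of the two error bounds *)

Unset Implicit Arguments.

Theorem theorem4 (R : realType) (n : nat) (f : vec R n -> \bar R)
    (M : set (vec R n)) (xbar : vec R n) :
  proper_fun f -> lsc f -> convex_fun f ->
  argmin f !=set0 -> argmin f xbar ->
  C1_submanifold M -> M xbar ->
  C1_partly_smooth_around f M xbar ->
  ri (lim_sub f xbar) (0%R : vec R n) ->
  (exists eps mu : R, 0 < eps /\ 0 < mu /\
     forall x, enorm (x - xbar) < eps ->
       (mu%:E * dist x (argmin f) <= dist (0%R : vec R n) (lim_sub f x))%E)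
  <->
  (exists eps mu : R, 0 < eps /\ 0 < mu /\
     forall x, M x -> enorm (x - xbar) < eps ->
       forall w, rgrad f M x w ->
         (mu%:E * dist x (argmin f `&` M) <= (enorm w)%:E)%E).
Proof.
move=> fp _ fc _ Sx sM Mx [dp [dp0 psa]] ri0.
have xx : enorm (xbar - xbar) = 0 by rewrite subrr enorm0.
have ps : partly_smooth_at f M xbar by apply: psa; rewrite ?xx.
have [m [F [DF [r ld]]]] := sM xbar Mx.
have [d1 [c [d10 c0 ident]]] := identification fp fc ps ri0 ld.
have [d2 d20 grad] := rgrad_csub fp fc ps ri0 ld.
have fS x : argmin f x -> csub f x 0.
  (* A minimal value is finite, being bounded by the value at a point of the domain. *)
  have [x0 fx0] := fp.2; move=> Sx'; apply: argmin_csub (Sx').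
  by apply: (proper_fin fp (r := fine (f x0))); rewrite fineK.
have SM b : enorm (b - xbar) < d1 -> argmin f b -> M b.
  by move=> bd /fS cb; apply: ident bd cb _; rewrite enorm0.
split=> [[eps [mu [eps0 [mu0 h]]]]|[eps [mu [eps0 [mu0 h]]]]].
  (* Half of [d1] ensures that the minimisers competing for the distance from [x] lie within [d1] of
     [xbar], hence on [M]. *)
  exists (Num.min (Num.min eps dp) (Num.min (d1 / 2) d2)), mu.
  split; first by rewrite !lt_min eps0 dp0 d20 divr_gt0.
  split=> // x Mx' /ltr_min2[/ltr_min2[xeps xdp] /ltr_min2[xd1 xd2]] w gw.
  have ne : csub f x !=set0.
    have [_ [[d [d0 hd]] _]] := psa x Mx' xdp.
    by have := hd x Mx'; rewrite subrr enorm0 lim_subE // => /(_ d0)[].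
  have cw := grad x w Mx' xd2 ne gw.
  have xd1' : 2 * enorm (x - xbar) < d1 by lra.
  apply: (@le_trans _ _ (mu%:E * dist x (argmin f))%E).
    by rewrite lee_pmul2l // (dist_setI Sx Mx SM).
  apply: (le_trans (h x xeps)).
  have lw : lim_sub f x w by rewrite lim_subE.
  by rewrite (le_trans (dist_le 0 lw)) // sub0r enormN.
(* A subgradient of norm at least [c] is handled by [c * enorm (x - xbar) <= c], which needs the
   radius at most [1]; a shorter one puts [x] on [M], where [mu] works. *)
exists (Num.min (Num.min eps dp) (Num.min d1 1)), (Num.min mu c).
split; first by rewrite !lt_min eps0 dp0 d10 ltr01.
split; first by rewrite lt_min mu0.
move=> x /ltr_min2[/ltr_min2[xeps xdp] /ltr_min2[xd1 x1]].
have muc0 : 0 <= Num.min mu c by rewrite le_min !ltW.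
(* The bound is proved for each subgradient separately, so an empty subdifferential, at distance
   [+oo], is covered. *)
apply: le_dist => v; rewrite lim_subE // sub0r enormN => cv.
have [cv'|vc] := leP c (enorm v).
  apply: (@le_trans _ _ ((Num.min mu c)%:E * (enorm (x - xbar))%:E)%E).
    by rewrite lee_wpmul2l ?lee_fin // dist_le.
  rewrite -EFinM lee_fin (le_trans _ cv') // -[leRHS]mulr1.
  by rewrite ler_pM ?enorm_ge0 ?(ltW x1) // ge_min lexx orbT.
have Mx' := ident x v xd1 cv vc.
have [w gw] := rgrad_exists sM (psa x Mx' xdp).
apply: (@le_trans _ _ (enorm w)%:E); last by rewrite lee_fin (rgrad_le Mx' cv gw).
apply: (le_trans _ (h x Mx' xeps w gw)).
apply: lee_pmul; rewrite ?lee_fin ?dist_ge0 ?ge_min ?lexx //.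
by apply: le_dist_subset => a [].
Qed.
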